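(* Let $\mathcal H$ be a real Hilbert space, let $f:\mathcal H\to\mathbb R\cup\{+\infty\}$ be convex, lower semicontinuous and proper with $\operatorname{argmin}_{\mathcal H}f\neq\emptyset$, and fix $\lambda>0$. Let $t_0>0$, $\alpha\ge 0$, and let $u:[t_0,+\infty[\to\mathcal H$ be a classical solution of $$\text{(TOGES-VR)}\qquad\dddot u(t)+\frac{\alpha+7}{t}\ddot u(t)+\frac{5(\alpha+1)}{t^2}\dot u(t)+\nabla f_\lambda\Big(u(t)+\tfrac14 t\dot u(t)\Big)=0,\quad t\ge t_0.$$ (a) If $\alpha\ge 3$, then as $t\to+\infty$: (i) $f_\lambda\big(u(t)+\tfrac14 t\dot u(t)\big)-\inf_{\mathcal H}f=\mathcal O(1/t^3)$ and $f\big(\operatorname{prox}_{\lambda f}(u(t)+\tfrac14 t\dot u(t))\big)-\inf_{\mathcal H}f=\mathcal O(1/t^3)$; (ii) $f_\lambda(u(t))-\inf_{\mathcal H}f=\mathcal O(1/t^3)$ and $f\big(\operatorname{prox}_{\lambda f}u(t)\big)-\inf_{\mathcal H}f=\mathcal O(1/t^3)$. (b) If $\alpha>3$, then as $t\to+\infty$: (iii) $f_\lambda\big(u(t)+\tfrac14 t\dot u(t)\big)-\inf_{\mathcal H}f=o(1/t^3)$ and $f\big(\operatorname{prox}_{\lambda f}(u(t)+\tfrac14 t\dot u(t))\big)-\inf_{\mathcal H}f=o(1/t^3)$; (iv) $f_\lambda(u(t))-\inf_{\mathcal H}f=o(1/t^3)$ and $f\big(\operatorname{prox}_{\lambda f}u(t)\big)-\inf_{\mathcal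 H}f=o(1/t^3)$; (v) $u(t)$ converges weakly to some $u_\infty\in\operatorname{argmin}_{\mathcal H}f$.
   Context: The Moreau envelope of index $\lambda>0$ is $f_\lambda(x)=\min_{\xi\in\mathcal H}\{f(\xi)+\frac1{2\lambda}\|x-\xi\|^2\}$; it is convex, continuously differentiable with Lipschitz gradient, $\inf f_\lambda=\inf f$ and $\operatorname{argmin}f_\lambda=\operatorname{argmin}f$. The proximal mapping $\operatorname{prox}_{\lambda f}x$ is the unique minimizer $\xi$ in the definition of $f_\lambda(x)$, i.e. $\operatorname{prox}_{\lambda f}=(I+\lambda\partial f)^{-1}$, so that $f_\lambda(x)=f(\operatorname{prox}_{\lambda f}x)+\frac1{2\lambda}\|x-\operatorname{prox}_{\lambda f}x\|^2$. *)

(* Defs.v *)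
From HB Require Import structures.
From mathcomp Require Import all_boot all_order all_algebra.
From mathcomp Require Import all_classical all_reals all_analysis.
Set Implicit Arguments. Unset Strict Implicit. Unset Printing Implicit Defensive.
Import Order.TTheory GRing.Theory Num.Theory.
Import numFieldNormedType.Exports.
Local Open Scope classical_set_scope.
Local Open Scope ring_scope.

(* A real Hilbert space: a complete normed space over R whose norm comes from
   a (symmetric, bilinear) inner product. *)
Record inner_product {R : realType} (V : completeNormedModType R) := {
  ip :> V -> V -> R;
  ip_sym : forall x y, ip x y = ip y x;
  ip_linear_l : forall a x y z, ip (a *: x + y) z = a * ip x z + ip y z;
  ip_norm : forall x, ip x x = `|x| ^+ 2 }.

Section Defs.
Context {R : realType} {V : completeNormedModType R}.
Local Open Scope ereal_scope.

Definition econvex (f : V -> \bar R) :=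
  forall (x y : V) (a : R), (0 < a < 1)%R ->
    f (a *: x + (1 - a) *: y)%R <= a%:E * f x + (1 - a)%:E * f y.

Definition eproper (f : V -> \bar R) :=
  (forall x, f x != -oo) /\ exists x, f x < +oo.

Definition einf (f : V -> \bar R) : \bar R := ereal_inf (range f).

Definition eargmin (f : V -> \bar R) : set V := [set x | forall y, f x <= f y].

Definition moreau (f : V -> \bar R) (lam : R) (x : V) : \bar R :=
  ereal_inf [set f xi + ((`|(x - xi)%R| ^+ 2) / (2 * lam))%:E | xi in [set: V]].

(* proximal point: the (unique, under the hypotheses) minimizer in the
   definition of the Moreau envelope *)
Definition is_prox (f : V -> \bar R) (lam : R) (x p : V) :=
  forall xi, f p + ((`|(x - p)%R| ^+ 2) / (2 * lam))%:E
               <= f xi + ((`|(x - xi)%R| ^+ 2) / (2 * lam))%:E.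

Definition prox (f : V -> \bar R) (lam : R) (x : V) : V :=
  get [set p | is_prox f lam x p].

Definition is_gradient (ipr : inner_product V) (F : V -> R) (x g : V) :=
  differentiable F x /\ forall h, 'd F x h = ipr g h.

End Defs.

(* Main.v *)
Require Import Defs.
From HB Require Import structures.
From mathcomp Require Import all_boot all_order all_algebra.
From mathcomp Require Import all_classical all_reals all_analysis.
From mathcomp Require Import ring lra.
Set Implicit Arguments.
Unset Strict Implicit.
Import Order.TTheory GRing.Theory Num.Theory.
Import numFieldNormedType.Exports.
Local Open Scope classical_set_scope.
Local Open Scope ring_scope.

(** With [F] the Moreau envelope and [w = u + (t/4) u'], the third order equation
    becomes [w'' + (alpha+1)/t w' + (t/4) grad F(w) = 0].  For a minimizer [z] put
    [W = t^3/4 (F(w) - min F) + t^2/2 |w'|^2] and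
    [K = alpha/2 |w - z|^2 + t <w - z, w'>].  For [3 <= c <= alpha] the function
    [W + c K] is nonnegative and nonincreasing; [c = 3] gives the [O(1/t^3)] rate.
    If [alpha > 3], comparing [c = 3] with [c = alpha] shows that [W] and [K] converge,
    that [W] tends to [0] (as [W/t] is integrable), and that [|w - z|] converges
    (as [K = alpha h + t h'] with [h = |w - z|^2/2]); Opial's argument then gives weak
    convergence of [w].  Everything passes from [w] to [u] because
    [(t^4 u)' = 4 t^3 w], i.e. [u] is a weighted average of [w]. *)

Section InnerProduct.
Context {R : realType} {H : completeNormedModType R} (ipr : inner_product H).
Implicit Types (x y z : H) (a : R).

Lemma ip_linear_r a x y z : ipr z (a *: x + y) = a * ipr z x + ipr z y.
Proof. by rewrite ip_sym ip_linear_l !(ip_sym ipr z). Qed.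

Lemma ip0l y : ipr 0 y = 0.
Proof. by have := ip_linear_l ipr 1 0 0 y; rewrite scale1r addr0; lra. Qed.

Lemma ip0r y : ipr y 0 = 0.
Proof. by rewrite ip_sym ip0l. Qed.

Lemma ipDl x y z : ipr (x + y) z = ipr x z + ipr y z.
Proof. by have := ip_linear_l ipr 1 x y z; rewrite scale1r mul1r. Qed.

Lemma ipDr x y z : ipr z (x + y) = ipr z x + ipr z y.
Proof. by rewrite ip_sym ipDl !(ip_sym ipr z). Qed.

Lemma ipZl a x z : ipr (a *: x) z = a * ipr x z.
Proof. by have := ip_linear_l ipr a x 0 z; rewrite ip0l !addr0. Qed.

Lemma ipZr a x z : ipr z (a *: x) = a * ipr z x.
Proof. by rewrite ip_sym ipZl !(ip_sym ipr z). Qed.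

Lemma ipNl x z : ipr (- x) z = - ipr x z.
Proof. by rewrite -scaleN1r ipZl mulN1r. Qed.

Lemma ipNr x z : ipr z (- x) = - ipr z x.
Proof. by rewrite ip_sym ipNl !(ip_sym ipr z). Qed.

Lemma ipBl x y z : ipr (x - y) z = ipr x z - ipr y z.
Proof. by rewrite ipDl ipNl. Qed.

Lemma ipBr x y z : ipr z (x - y) = ipr z x - ipr z y.
Proof. by rewrite ipDr ipNr. Qed.

Lemma ip_ge0 x : 0 <= ipr x x.
Proof. by rewrite ip_norm exprn_ge0. Qed.

Lemma ip_eq0 x : ipr x x = 0 -> x = 0.
Proof. by move=> /eqP; rewrite ip_norm sqrf_eq0 normr_eq0 => /eqP. Qed.

Lemma cauchy_schwarz x y : `|ipr x y| <= `|x| * `|y|.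
Proof.
have key : ipr x y ^+ 2 <= (`|x| * `|y|) ^+ 2.
  rewrite exprMn -!(ip_norm ipr).
  have [y0|y0] := eqVneq (ipr y y) 0.
    by rewrite (ip_eq0 y0) !ip0r expr2 !mulr0.
  have yp : 0 < ipr y y by rewrite lt0r y0 ip_ge0.
  have := ip_ge0 (x - (ipr x y / ipr y y) *: y).
  rewrite ipBl !ipBr !ipZl !ipZr (ip_sym ipr y x) => h.
  have h2 : 0 <= ipr x x - ipr x y ^+ 2 / ipr y y.
    by apply: le_trans h _; rewrite le_eqVlt; apply/orP; left; apply/eqP; field.
  by move: h2; rewrite subr_ge0 ler_pdivrMr.
by rewrite -(@ler_pXn2r _ 2) ?nnegrE ?mulr_ge0// real_normK ?num_real.
Qed.

Lemma cvg_ip {T : Type} {F : set_system T} {FF : Filter F} (p q : T -> H) x y :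
  p @ F --> x -> q @ F --> y -> ipr (p t) (q t) @[t --> F] --> ipr x y.
Proof.
move=> px qy.
apply/subr_cvg0.
have h1 : `|p t - x| * `|q t - y| + `|p t - x| * `|y| + `|x| * `|q t - y|
    @[t --> F] --> (0 : R).
  have n0 : 0 = `|x - x| * `|y - y| + `|x - x| * `|y| + `|x| * `|y - y| :> R.
    by rewrite !subrr !normr0 !mul0r mulr0 !addr0.
  rewrite [X in _ --> X]n0.
  have pp : `|p t - x| @[t --> F] --> `|x - x|.
    by apply: cvg_norm; apply: cvgB px _; exact: cvg_cst.
  have qq : `|q t - y| @[t --> F] --> `|y - y|.
    by apply: cvg_norm; apply: cvgB qy _; exact: cvg_cst.
  exact: cvgD (cvgD (cvgM pp qq) (cvgM pp (cvg_cst _))) (cvgM (cvg_cst _) qq).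
apply/norm_cvg0P; apply: (squeeze_cvgr _ (cvg_cst 0) h1).
near=> t; rewrite normr_ge0/=.
have -> : ipr (p t) (q t) - ipr x y = ipr (p t - x) (q t - y) + ipr (p t - x) y
    + ipr x (q t - y) by rewrite !(ipBl, ipBr); ring.
apply: le_trans (ler_normD _ _) _; apply: lerD; last exact: cauchy_schwarz.
by apply: le_trans (ler_normD _ _) _; apply: lerD; exact: cauchy_schwarz.
Unshelve. all: by end_near. Qed.

End InnerProduct.

Section Derivatives.
Context {R : realType}.

Lemma is_deriveP {W : normedModType R} (f : R -> W) (t : R) (d : W) :
  is_derive t 1 f d <->
  h^-1 *: (f (h + t) - f t) @[h --> (0 : R)^'] --> d.
Proof.
have E : (fun h : R => h^-1 *: ((f \o shift t) (h *: (1 : R)) - f t)) =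
         (fun h : R => h^-1 *: (f (h + t) - f t)).
  by apply/funext => h /=; rewrite [h *: _]mulr1.
split=> [[df <-]|fd]; first by rewrite /derive -E; exact: df.
split; first by apply/cvg_ex; exists d; rewrite E.
by rewrite /derive E; exact: cvg_lim.
Qed.

Lemma is_derive_cvg {W : normedModType R} (f : R -> W) (t : R) (d : W) :
  is_derive t 1 f d -> f (h + t) @[h --> (0 : R)^'] --> f t.
Proof.
move=> [/derivable1_diffP /differentiable_continuous ft _].
have s : h + t @[h --> (0 : R)^'] --> t.
  by rewrite -[X in _ --> X]add0r; apply: cvgD; [exact: nbhs_dnbhs|exact: cvg_cst].
exact: (cvg_comp _ _ s ft).
Qed.

Lemma is_derive_bilinear {U V W : normedModType R} (B : U -> V -> W)
    (p : R -> U) (q : R -> V) (t : R) (dp : U) (dq : V) :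
  (forall a x x' y, B (a *: (x - x')) y = a *: (B x y - B x' y)) ->
  (forall a x y y', B x (a *: (y - y')) = a *: (B x y - B x y')) ->
  (forall (F : set_system R) {FF : Filter F} (f : R -> U) (g : R -> V) x y,
    f @ F --> x -> g @ F --> y -> B (f s) (g s) @[s --> F] --> B x y) ->
  is_derive t 1 p dp -> is_derive t 1 q dq ->
  is_derive t 1 (fun s => B (p s) (q s)) (B dp (q t) + B (p t) dq).
Proof.
move=> Bl Br Bc pt qt; apply/is_deriveP.
have -> : (fun h : R => h^-1 *: (B (p (h + t)) (q (h + t)) - B (p t) (q t))) =
    (fun h : R => B (h^-1 *: (p (h + t) - p t)) (q (h + t))
                  + B (p t) (h^-1 *: (q (h + t) - q t))).
  by apply/funext => h; rewrite Bl Br -scalerDr addrA subrK.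
apply: cvgD; apply: Bc.
- exact/is_deriveP.
- exact: is_derive_cvg qt.
- exact: cvg_cst.
- exact/is_deriveP.
Qed.

Lemma is_derive_scale {W : normedModType R} (k : R -> R) (f : R -> W)
    (t dk : R) (df : W) :
  is_derive t 1 k dk -> is_derive t 1 f df ->
  is_derive t 1 (fun s => k s *: f s) (dk *: f t + k t *: df).
Proof.
apply: (@is_derive_bilinear R^o W W (fun a x => a *: x)).
- by move=> a x x' y; rewrite -scalerBl scalerA.
- by move=> a x y y'; rewrite scalerA mulrC -scalerA scalerBr.
- by move=> F FF g h x y; exact: cvgZ.
Qed.

Lemma is_derive_ip {H : completeNormedModType R} (ipr : inner_product H)
    (p q : R -> H) (t : R) (dp dq : H) :
  is_derive t 1 p dp -> is_derive t 1 q dq ->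
  is_derive t 1 (fun s => ipr (p s) (q s)) (ipr dp (q t) + ipr (p t) dq).
Proof.
apply: (@is_derive_bilinear H H R^o).
- by move=> a x x' y; rewrite ipZl ipBl.
- by move=> a x y y'; rewrite ipZr ipBr.
- by move=> F FF f g x y; exact: cvg_ip.
Qed.

Lemma is_derive_diff_comp {H : normedModType R} (F : H -> R) (w : R -> H)
    (t : R) (dw : H) :
  differentiable F (w t) -> is_derive t 1 w dw ->
  is_derive t 1 (F \o w) ('d F (w t) dw).
Proof.
move=> dF [/derivable1_diffP wd <-].
have Fw : differentiable (F \o w) t by exact: differentiable_comp.
by split; [exact/derivable1_diffP|rewrite !deriveE// diff_comp].
Qed.

Lemma is_derive_sub_le (f df : R -> R) (t1 c s t : R) :
  (forall x, t1 < x -> is_derive x 1 f (df x)) ->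
  (forall x, t1 < x -> df x <= c) ->
  t1 < s -> s <= t -> f t - f s <= c * (t - s).
Proof.
move=> fd dfc t1s st.
have [| |x xst ->] := MVT_segment st (f := f) (df := df).
- by move=> x; rewrite in_itv/= => /andP[sx _]; apply: fd; exact: lt_trans sx.
- apply: derivable_within_continuous => x; rewrite in_itv/= => /andP[sx _].
  by apply: ex_derive; apply: fd; exact: lt_le_trans sx.
- apply: ler_wpM2r; first by rewrite subr_ge0.
  by apply: dfc; move: xst; rewrite in_itv/= => /andP[sx _]; exact: lt_le_trans sx.
Qed.

End Derivatives.

Section Proximal.
Context {R : realType} {H : completeNormedModType R}.
Implicit Types (f : H -> \bar R) (x y : H).

Lemma normD2 (ipr : inner_product H) x y :
  `|x + y| ^+ 2 = `|x| ^+ 2 + 2 * ipr x y + `|y| ^+ 2.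
Proof. by rewrite -!(ip_norm ipr) ipDl !ipDr (ip_sym ipr y x); ring. Qed.

Lemma norm_convex_comb (ipr : inner_product H) (c : R) x y :
  `|c *: x + (1 - c) *: y| ^+ 2 =
  c * `|x| ^+ 2 + (1 - c) * `|y| ^+ 2 - c * (1 - c) * `|x - y| ^+ 2.
Proof.
rewrite -!(ip_norm ipr) !(ipDl, ipDr, ipNl, ipNr, ipZl, ipZr) (ip_sym ipr y x).
by ring.
Qed.

(* Convexity of f and the parallelogram law at the midpoint of a and b. *)
Lemma almost_min_dist (ipr : inner_product H) f (lam : R) x a b (r e fa fb : R) :
  0 < lam -> econvex f -> f a = fa%:E -> f b = fb%:E ->
  (forall xi, (r%:E <= f xi + (`|x - xi| ^+ 2 / (2 * lam))%:E)%E) ->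
  fa + `|x - a| ^+ 2 / (2 * lam) <= r + e ->
  fb + `|x - b| ^+ 2 / (2 * lam) <= r + e ->
  `|a - b| ^+ 2 <= 8 * lam * e.
Proof.
move=> lam0 cf fae fbe lb ha hb.
have h01 : 0 < (2^-1 : R) < 1 by lra.
have := cf a b _ h01; rewrite fae fbe -!EFinM -EFinD => fm.
have := le_trans (lb (2^-1 *: a + (1 - 2^-1) *: b)) (leeD2r _ fm).
rewrite -EFinD lee_fin.
have -> : x - (2^-1 *: a + (1 - 2^-1) *: b) =
    2^-1 *: (x - a) + (1 - 2^-1) *: (x - b).
  rewrite !scalerBr opprD [RHS]addrACA -scalerDl.
  by rewrite (_ : 2^-1 + (1 - 2^-1) = 1 :> R) ?scale1r//; lra.
rewrite (norm_convex_comb ipr).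
have -> : x - a - (x - b) = - (a - b).
  by rewrite opprB addrC addrA subrK opprB.
rewrite normrN => hm.
rewrite [8 * lam * e]mulrC -ler_pdivrMr; last by lra.
have l0 : (2 * lam)^-1 > 0 by rewrite invr_gt0; lra.
have e8 : (8 * lam)^-1 = (2 * lam)^-1 / 4 by field; lra.
rewrite e8; move: hm ha hb l0; move: ((2 * lam)^-1) => k.
set A := `|x - a| ^+ 2; set B := `|x - b| ^+ 2; set D := `|a - b| ^+ 2.
nra.
Qed.

Lemma exists_prox (ipr : inner_product H) f (lam M : R) x :
  0 < lam -> econvex f -> lower_semicontinuous f -> eproper f ->
  (forall xi, (M%:E <= f xi + (`|x - xi| ^+ 2 / (2 * lam))%:E)%E) ->
  exists p, is_prox f lam x p.
Proof.
move=> lam0 cf lf [fN [y0 fy0]] fM.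
pose q xi := `|x - xi| ^+ 2 / (2 * lam).
have Ilb xi : (moreau f lam x <= f xi + (q xi)%:E)%E.
  by apply: ereal_inf_lbound; exists xi.
have Ifin : moreau f lam x \is a fin_num.
  rewrite fin_numE; apply/andP; split.
    rewrite gt_eqF//; apply: (@lt_le_trans _ _ M%:E); first exact: ltNyr.
    by apply: le_ereal_inf_tmp => _ [xi _ <-]; exact: fM.
  rewrite lt_eqF//; apply: le_lt_trans (Ilb y0) _.
  by rewrite lte_add_pinfty// ltry.
pose r := fine (moreau f lam x).
have Ir : moreau f lam x = r%:E by rewrite fineK.
have rlb xi : (r%:E <= f xi + (q xi)%:E)%E by rewrite -Ir.
have /choice[xi hxi] : forall n : nat, exists z,
    (f z + (q z)%:E <= (r + n.+1%:R^-1)%:E)%E.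
  move=> n; have n0 : 0 < (n.+1%:R^-1 : R) by rewrite invr_gt0.
  have [_ [z _ <-] hz] := lb_ereal_inf_adherent n0 Ifin.
  by exists z; apply: ltW; move: hz; rewrite -/(moreau f lam x) Ir -EFinD.
have fxi n : f (xi n) = (fine (f (xi n)))%:E.
  rewrite fineK// fin_numE fN/=; apply/eqP => fy.
  by move: (hxi n); rewrite fy.
have hxiR n : fine (f (xi n)) + q (xi n) <= r + n.+1%:R^-1.
  by rewrite -lee_fin EFinD -fxi.
have dxi (N n : nat) : (N <= n)%N ->
    `|xi N - xi n| ^+ 2 <= 8 * lam * N.+1%:R^-1.
  move=> Nn; apply: (almost_min_dist ipr lam0 cf (fxi _) (fxi _) rlb) => //.
  apply: le_trans (hxiR n) _; rewrite lerD2l lef_pV2 ?posrE//.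
  by rewrite ler_nat.
have cxi : cvg (xi @ \oo).
  apply: cauchy_cvg; apply: cauchy_exP => e e0.
  have e20 : 0 < e ^+ 2 / (8 * lam) by rewrite divr_gt0 ?exprn_gt0//; lra.
  have [N _ hN] := near_infty_natSinv_lt (PosNum e20).
  exists (xi N); exists N => // n /= Nn.
  rewrite -ball_normE /=.
  rewrite -(@ltr_pXn2r _ 2) ?nnegrE//; last exact: ltW.
  apply: le_lt_trans (dxi _ _ Nn) _.
  have /= := hN N (leqnn _); rewrite ltr_pdivlMr; last by lra.
  by rewrite mulrC.
pose p := lim (xi @ \oo).
have xip : xi @ \oo --> p by [].
exists p => z; apply: le_trans (rlb z).
rewrite -/(q p) -leeBrDr// -EFinB leNgt; apply/negP => hlt.
have [a ra af] : exists2 a : R, r - q p < a & (a%:E < f p)%E.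
  move: hlt (fN p); case: (f p) => [v| |]//; last first.
    by move=> _ _; exists (r - q p + 1); [lra|exact: ltry].
  rewrite lte_fin => hv _; exists ((r - q p + v) / 2); rewrite ?lte_fin; lra.
have [V Vp hV] := lf p a af.
have c1 : r + n.+1%:R^-1 - q (xi n) @[n --> \oo] --> r + 0 - q p.
  apply: cvgB.
    by apply: cvgD; [exact: cvg_cst|exact: cvg_harmonic].
  apply: cvgM; last exact: cvg_cst.
  have c0 : `|x - xi n| @[n --> \oo] --> `|x - p|.
    by apply: cvg_norm; apply: cvgB xip; exact: cvg_cst.
  by rewrite expr2; under eq_fun do rewrite expr2; exact: cvgM.
have ra0 : r + 0 - q p < a by rewrite addr0.
have n1 : \forall n \near \oo, r + n.+1%:R^-1 - q (xi n) < a.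
  exact: (cvgr_lt _ c1).
have n2 : \forall n \near \oo, V (xi n) by exact: xip.
have [n [h1 /hV]] := filter_ex (filterI n1 n2).
by rewrite fxi lte_fin => /(lt_trans h1); rewrite ltNge lerBrDr hxiR.
Qed.

Lemma riesz_representation (ipr : inner_product H) (L : H -> R) (B : R) :
  (forall a x y, L (a *: x + y) = a * L x + L y) ->
  (forall x, `|L x| <= B * `|x|) ->
  exists z, forall y, L y = ipr z y.
Proof.
move=> Llin LB.
have LD x y : L (x + y) = L x + L y by have := Llin 1 x y; rewrite scale1r mul1r.
have L0 : L 0 = 0 by have := LD 0 0; rewrite addr0; lra.
have LZ a x : L (a *: x) = a * L x by have := Llin a x 0; rewrite !addr0 L0 addr0.
have LN x : L (- x) = - L x by rewrite -scaleN1r LZ mulN1r.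
have [p pP] : exists p, is_prox (fun x => (- L x)%:E) 2^-1 0 p.
  apply: (@exists_prox ipr _ _ (- (B ^+ 2 / 4))).
  - by lra.
  - move=> x y a _; rewrite -!EFinM -EFinD lee_fin Llin LZ.
    by rewrite le_eqVlt; apply/orP; left; apply/eqP; ring.
  - move=> x a; rewrite lte_fin => ax.
    have B0 : 0 <= `|B| + 1 by rewrite addr_ge0.
    have e0 : 0 < (- L x - a) / (`|B| + 1).
      by apply: divr_gt0; [lra|rewrite ltr_wpDl].
    exists (ball x ((- L x - a) / (`|B| + 1))); first exact: nbhsx_ballx.
    move=> y; rewrite -ball_normE /= => xy; rewrite lte_fin.
    have h1 : `|L (x - y)| <= (`|B| + 1) * `|x - y|.
      apply: le_trans (LB _) _; apply: ler_wpM2r => //.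
      by have := ler_norm B; lra.
    have h2 : (`|B| + 1) * `|x - y| < - L x - a.
      by rewrite mulrC -ltr_pdivlMr// ltr_wpDl.
    move: (le_lt_trans h1 h2); rewrite LD LN ltr_norml => /andP[]; lra.
  - by split => //; exists 0; rewrite ltry.
  - move=> x; rewrite -EFinD lee_fin sub0r normrN divff ?divr1; last by lra.
    have := le_trans (ler_norm _) (LB x).
    by have := sqr_ge0 (`|x| - B / 2); nra.
exists (2 *: p) => y.
have key s : 0 <= s * (2 * ipr p y - L y) + s ^+ 2 * `|y| ^+ 2.
  have := pP (p + s *: y); rewrite -!EFinD lee_fin !sub0r !normrN.
  rewrite divff ?divr1; last by lra.
  rewrite (normD2 ipr) LD LZ ipZr normrZ exprMn real_normK ?num_real//; lra.
rewrite ipZl; apply/esym/eqP; rewrite -subr_eq0; apply/negPn/negP => d0.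
set d := 2 * ipr p y - L y in key d0.
have D0 : 0 < d ^+ 2 by rewrite exprn_even_gt0.
have n0 : 0 < `|y| ^+ 2 + 1 by rewrite ltr_wpDl// exprn_ge0.
have := key (- d / (`|y| ^+ 2 + 1)).
have -> : - d / (`|y| ^+ 2 + 1) * d + (- d / (`|y| ^+ 2 + 1)) ^+ 2 * `|y| ^+ 2 =
  - (d ^+ 2 / (`|y| ^+ 2 + 1) ^+ 2) by field; lra.
rewrite oppr_ge0 leNgt => /negP; apply; rewrite divr_gt0// exprn_gt0//.
Qed.

End Proximal.

Section Gradient.
Context {R : realType} {H : completeNormedModType R} (ipr : inner_product H).

Definition ip_form (g : H) : H -> R^o := ipr g.

Lemma ip_form_is_linear g : linear (ip_form g).
Proof. by move=> a x y; rewrite /ip_form ip_linear_r. Qed.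

HB.instance Definition _ g :=
  @GRing.isLinear.Build R H R^o *:%R (ip_form g) (ip_form_is_linear g).

Lemma ip_form_continuous g : continuous (ip_form g).
Proof. by move=> x; apply: cvg_ip; [exact: cvg_cst|exact: cvg_id]. Qed.

Lemma is_gradient_of_quadratic_bound (F : H -> R) (x g : H) (C : R) :
  (forall h, `|F (x + h) - F x - ipr g h| <= C * `|h| ^+ 2) ->
  is_gradient ipr F x g.
Proof.
move=> FC.
have gc : continuous (ip_form g) by exact: ip_form_continuous.
have Fo : (F : H -> R^o) \o shift x = cst (F x) + ip_form g +o_ 0 id.
  apply/eqaddoP => e e0.
  have C0 : 0 < `|C| + 1 by rewrite ltr_wpDl.
  have d0 : 0 < e / (`|C| + 1) by rewrite divr_gt0.
  near=> h.
  have hd : `|h| < e / (`|C| + 1) by near: h; exact: nbhs0_lt.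
  have -> : ((F : H -> R^o) \o shift x - (cst (F x) + ip_form g)) h =
      F (x + h) - F x - ipr g h.
    by rewrite /ip_form !fctE /= [h + x]addrC opprD addrA.
  apply: le_trans (FC h) _; rewrite expr2 mulrA; apply: ler_wpM2r => //.
  have hC : (`|C| + 1) * `|h| <= e.
    by rewrite mulrC -ler_pdivlMr// ltW.
  apply: le_trans hC; apply: ler_wpM2r => //.
  by have := ler_norm C; lra.
have dE : 'd (F : H -> R^o) x = ip_form g :> (H -> R^o) by exact: diff_unique.
split; last by move=> h; rewrite dE.
by apply/diff_locallyP; rewrite dE.
Unshelve. all: by end_near. Qed.

End Gradient.

Section Moreau.
Context {R : realType} {H : completeNormedModType R} (ipr : inner_product H).
Context (f : H -> \bar R) (lam : R) (xs : H).
Context (cf : econvex f) (lf : lower_semicontinuous f) (pf : eproper f).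
Context (xsP : eargmin f xs) (lam0 : 0 < lam).
Implicit Types x y : H.

Let p := prox f lam.
Let F x := fine (moreau f lam x).
Let m := fine (f xs).

Let l2 : 0 < 2 * lam. Proof. exact: mulr_gt0. Qed.

Let q_ge0 x : 0 <= `|x| ^+ 2 / (2 * lam).
Proof. by rewrite divr_ge0 ?exprn_ge0// ltW. Qed.

Lemma fin_argmin : f xs = m%:E.
Proof.
have [fN [y fy]] := pf; rewrite /m fineK// fin_numE fN/= lt_eqF//.
exact: le_lt_trans (xsP y) fy.
Qed.

Lemma argmin_le y : (m%:E <= f y)%E.
Proof. by rewrite -fin_argmin. Qed.

Lemma proxP x : is_prox f lam x (p x).
Proof.
have [z zP] : exists z, is_prox f lam x z.
  apply: (exists_prox ipr (M := m)) => // xi.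
  apply: le_trans (argmin_le xi) _.
  by rewrite leeDl// lee_fin; exact: q_ge0.
exact: (@getPex _ [set z | is_prox f lam x z] (ex_intro _ z zP)).
Qed.

Lemma fin_prox x : f (p x) = (fine (f (p x)))%:E.
Proof.
have [fN _] := pf; rewrite fineK// fin_numE fN/=; apply/eqP => fy.
by have := proxP x xs; rewrite fy fin_argmin -EFinD.
Qed.

Lemma moreau_prox x :
  moreau f lam x = (fine (f (p x)) + `|x - p x| ^+ 2 / (2 * lam))%:E.
Proof.
rewrite EFinD -fin_prox; apply/eqP; rewrite eq_le; apply/andP; split.
  by apply: ereal_inf_lbound; exists (p x).
by apply: le_ereal_inf_tmp => _ [xi _ <-]; exact: proxP.
Qed.

Lemma fin_moreau x : moreau f lam x = (F x)%:E.
Proof. by rewrite /F moreau_prox. Qed.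

Lemma moreauE x : F x = fine (f (p x)) + `|x - p x| ^+ 2 / (2 * lam).
Proof. by rewrite /F moreau_prox. Qed.

Lemma moreau_le x xi (r : R) : (f xi <= r%:E)%E ->
  F x <= r + `|x - xi| ^+ 2 / (2 * lam).
Proof.
move=> fxi; rewrite -lee_fin -fin_moreau EFinD.
apply: (@le_trans _ _ (f xi + (`|x - xi| ^+ 2 / (2 * lam))%:E)%E).
  by apply: ereal_inf_lbound; exists xi.
exact: leeD2r.
Qed.

Lemma min_le_prox x : m <= fine (f (p x)).
Proof. by rewrite -lee_fin -fin_prox argmin_le. Qed.

Lemma prox_le_moreau x : fine (f (p x)) <= F x.
Proof. by rewrite moreauE lerDl. Qed.

Lemma min_le_moreau x : m <= F x.
Proof. exact: le_trans (min_le_prox x) (prox_le_moreau x). Qed.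

Lemma moreau_argmin y : eargmin f y -> F y = m.
Proof.
move=> yP; apply/le_anti; rewrite min_le_moreau andbT.
have := @moreau_le y y m; rewrite subrr normr0 expr0n/= mul0r addr0; apply.
by rewrite -fin_argmin.
Qed.

Lemma argmin_moreau y : F y = m -> eargmin f y.
Proof.
move=> Fy; have h1 := min_le_prox y; have h2 := q_ge0 (y - p y).
have h3 : `|y - p y| ^+ 2 / (2 * lam) = 0 by have := moreauE y; lra.
have h4 : fine (f (p y)) = m by have := moreauE y; lra.
have yp : y = p y.
  apply/eqP; rewrite -subr_eq0 -normr_eq0 -sqrf_eq0.
  by move/eqP: h3; rewrite mulf_eq0 invr_eq0 [X in _ || X]gt_eqF// orbF.
by move=> z; rewrite yp fin_prox h4 argmin_le.
Qed.

Lemma einf_argmin : einf f = m%:E.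
Proof.
apply/eqP; rewrite eq_le; apply/andP; split.
  by rewrite -fin_argmin; apply: ereal_inf_lbound; exists xs.
by apply: le_ereal_inf_tmp => _ [y _ <-]; exact: argmin_le.
Qed.

Lemma value_gap_le x (r : R) : F x - m <= r ->
  (moreau f lam x - einf f <= r%:E)%E /\ (f (p x) - einf f <= r%:E)%E.
Proof.
move=> Fr; rewrite einf_argmin fin_moreau (fin_prox x) -!EFinB !lee_fin; split=> //.
by apply: le_trans Fr; rewrite lerD2r prox_le_moreau.
Qed.

Lemma moreau_convex (a : R) x y : 0 < a < 1 ->
  F (a *: x + (1 - a) *: y) <= a * F x + (1 - a) * F y.
Proof.
move=> a01; have := cf (p x) (p y) a01; rewrite (fin_prox x) (fin_prox y) -!EFinM -EFinD.
move=> /(@moreau_le (a *: x + (1 - a) *: y)) /le_trans; apply.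
have -> : a *: x + (1 - a) *: y - (a *: p x + (1 - a) *: p y) =
    a *: (x - p x) + (1 - a) *: (y - p y).
  by rewrite !scalerBr opprD addrACA.
rewrite (norm_convex_comb ipr) !moreauE.
have := q_ge0 (x - p x - (y - p y)).
have a1 : 0 <= a * (1 - a) by case/andP: a01 => ? ?; rewrite mulr_ge0//; lra.
move=> /(mulr_ge0 a1); move: ((2 * lam)^-1) => k; lra.
Qed.

Lemma moreau_gradient x : exists2 g, is_gradient ipr F x g &
  forall y, F x + ipr g (y - x) <= F y.
Proof.
pose k := (2 * lam)^-1; have k0 : 0 < k by rewrite invr_gt0.
pose g := (2 * k) *: (x - p x).
have up h : F (x + h) <= F x + ipr g h + k * `|h| ^+ 2.
  have /(@moreau_le (x + h)) : (f (p x) <= (fine (f (p x)))%:E)%E by rewrite -fin_prox.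
  rewrite -addrA [h + _]addrC addrA (normD2 ipr) -/k => /le_trans; apply.
  by rewrite moreauE -/k /g ipZl; lra.
have lo h : F x + ipr g h - k * `|h| ^+ 2 <= F (x + h).
  have h01 : 0 < (2^-1 : R) < 1 by lra.
  have := @moreau_convex 2^-1 (x + h) (x - h) h01.
  have -> : 2^-1 *: (x + h) + (1 - 2^-1) *: (x - h) = x.
    rewrite (_ : 1 - 2^-1 = 2^-1 :> R); last by lra.
    rewrite -scalerDr addrCA addrK -[x in x + x]scale1r -scalerDl scalerA.
    by rewrite (_ : 2^-1 * (1 + 1) = 1 :> R) ?scale1r//; lra.
  by have := up (- h); rewrite normrN ipNr; lra.
exists g.
  apply: (@is_gradient_of_quadratic_bound _ _ _ _ _ _ k) => h.
  by rewrite ler_norml; have := up h; have := lo h; lra.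
move=> y; apply/ler_addgt0Pr => e e0.
pose C := k * `|y - x| ^+ 2; have C0 : 0 <= C by rewrite mulr_ge0// ltW.
have eC : 0 < e + C + 1 by lra.
pose s := e / (e + C + 1).
have s01 : 0 < s < 1 by rewrite divr_gt0//= ltr_pdivrMr//; lra.
have := @moreau_convex s y x s01.
have -> : s *: y + (1 - s) *: x = x + s *: (y - x).
  by rewrite scalerBl scale1r scalerBr addrCA.
move=> h1; have := lo (s *: (y - x)); rewrite normrZ exprMn ipZr.
rewrite real_normK ?num_real// => h2.
have sC : s * C <= e.
  rewrite /s mulrAC ler_pdivrMr//; nra.
have s0 : 0 < s by case/andP: s01.
suff : s * (F x + ipr g (y - x)) <= s * (F y + e) by rewrite ler_pM2l.
have : s * (s * C) <= s * e by rewrite ler_pM2l.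
by move: h1 h2; rewrite /C; lra.
Qed.

End Moreau.

Section Asymptotics.
Context {R : realType}.
Implicit Types (h E : R -> R).

Lemma near_pinftyP (P : R -> Prop) (t1 : R) :
  (\forall t \near +oo, P t) -> exists2 T, t1 < T & forall t, T <= t -> P t.
Proof.
move=> [M [_ MP]]; exists (Num.max M t1 + 1) => [|t].
  by rewrite (le_lt_trans (_ : t1 <= Num.max M t1)) ?le_max ?lexx ?orbT// ltrDl.
move=> Mt; apply: MP; apply: lt_le_trans Mt.
by rewrite (le_lt_trans (_ : M <= Num.max M t1)) ?le_max ?lexx// ltrDl.
Qed.

Lemma near_pinfty_ge (P : R -> Prop) (T : R) :
  (forall t, T <= t -> P t) -> \forall t \near +oo, P t.
Proof. by move=> TP; exists T; split; rewrite ?num_real// => t /ltW /TP. Qed.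

Lemma nonincreasing_ge0_cvg E (t1 : R) :
  (forall s t, t1 < s -> s <= t -> E t <= E s) ->
  (forall t, t1 < t -> 0 <= E t) -> exists l : R, E t @[t --> +oo] --> l.
Proof.
move=> Ed E0; pose g t := - E (Num.max t (t1 + 1)).
have t1m t : t1 < Num.max t (t1 + 1) by rewrite lt_max ltrDl ltr01 orbT.
have gn : nondecreasing_fun g.
  move=> s t st; rewrite lerN2; apply: Ed => //.
  by rewrite ge_max !le_max st lexx orbT.
have gu : has_ubound (range g).
  by exists 0 => _ [t _ <-]; rewrite oppr_le0 E0.
have /cvgN gl := nondecreasing_cvgr gn gu.
eexists; apply: cvg_trans gl; apply: near_eq_cvg.
apply: (@near_pinfty_ge _ (t1 + 1)) => t tt /=.
by rewrite fctE /g opprK; rewrite max_l.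
Qed.

(* The function t^a (h - c) has derivative t^(a-1) (a h + t h' - a c). *)
Lemma avg_le (a c t1 e : R) h (dh : R -> R) : 1 <= a -> 0 < e ->
  (forall t, t1 < t -> is_derive t 1 h (dh t)) ->
  (\forall t \near +oo, a * h t + t * dh t <= a * c) ->
  \forall t \near +oo, h t <= c + e.
Proof.
move=> a1 e0 hd /(near_pinftyP (Num.max t1 1)) [T].
rewrite gt_max => /andP[t1T oneT] hT.
pose phi t := t `^ a * (h t - c).
have phid t : T < t -> is_derive t 1 phi (t `^ (a - 1) * (a * h t + t * dh t - a * c)).
  move=> Tt; have t0 : 0 < t by lra.
  have ha := hd t (lt_trans t1T Tt).
  have pd := is_derive1_powR a t0.
  have -> : phi = (fun t => t `^ a) * (h - cst c) by apply/funext.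
  apply: is_derive_eq.
  have a0 : 0 < a by lra.
  rewrite !fctE /= subr0 -(mulr_powRB1 (ltW t0) a0) /GRing.scale/=; ring.
have phile t : T < t -> t `^ (a - 1) * (a * h t + t * dh t - a * c) <= 0.
  by move=> Tt; rewrite mulr_ge0_le0 ?powR_ge0// subr_le0 hT// ltW.
pose s := T + 1; have Ts : T < s by rewrite ltrDl.
apply: (@near_pinfty_ge _ (Num.max s (`|phi s| / e))) => t.
rewrite ge_max => /andP[st pt].
have t1' : 1 <= t by rewrite /s in st; lra.
have t0 : 0 < t by lra.
have := is_derive_sub_le phid phile Ts st; rewrite mul0r subr_le0 => phits.
have ta : t <= t `^ a by exact: le1r_powR.
have p0 : 0 < t `^ a by exact: powR_gt0.
have h1 : t `^ a * (h t - c) <= t `^ a * e.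
  apply: le_trans phits _; apply: le_trans (ler_norm _) _.
  rewrite ler_pdivrMr// in pt; apply: le_trans pt _.
  by rewrite ler_pM2r.
by rewrite ler_pM2l// in h1; lra.
Qed.

Lemma avg_cvg (a l t1 : R) h (dh : R -> R) : 1 <= a ->
  (forall t, t1 < t -> is_derive t 1 h (dh t)) ->
  a * h t + t * dh t @[t --> +oo] --> l -> h t @[t --> +oo] --> l / a.
Proof.
move=> a1 hd hl; have a0 : 0 < a by lra.
apply/cvgrPdist_le => e e0; have e20 : 0 < e / 2 by lra.
have ae : 0 < a * (e / 2) by rewrite mulr_gt0.
have la : a * (l / a) = l by field; lra.
have hNd t : t1 < t -> is_derive t 1 (- h) (- dh t).
  by move=> /hd ?; exact: is_deriveN.
have up : \forall t \near +oo, h t <= (l / a + e / 2) + e / 2.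
  apply: (avg_le a1 e20 hd); move/cvgrPdist_le: hl => /(_ _ ae).
  apply: filterS => t; rewrite ler_norml; lra.
have lo : \forall t \near +oo, (- h) t <= (- (l / a) + e / 2) + e / 2.
  apply: (avg_le a1 e20 hNd); move/cvgrPdist_le: hl => /(_ _ ae).
  apply: filterS => t; rewrite ler_norml fctE; lra.
near=> t; rewrite ler_norml.
have h1 : h t <= (l / a + e / 2) + e / 2 by near: t.
have h2 : (- h) t <= (- (l / a) + e / 2) + e / 2 by near: t.
by rewrite fctE in h2; lra.
Unshelve. all: by end_near. Qed.

(* Otherwise W >= l / 2 eventually, and E + (l / 2) ln t would be nonincreasing. *)
Lemma dissipated_limit_le0 (E dE W : R -> R) (l t1 : R) : 0 <= t1 ->
  (forall t, t1 < t -> 0 <= E t) ->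
  (forall t, t1 < t -> is_derive t 1 E (dE t)) ->
  (forall t, t1 < t -> dE t <= - (W t / t)) ->
  W t @[t --> +oo] --> l -> l <= 0.
Proof.
move=> t10 E0 Ed dEW Wl; rewrite leNgt; apply/negP => l0.
have l2 : l / 2 < l by lra.
have [T t1T WT] := near_pinftyP t1 (cvgr_gt _ Wl _ l2).
pose phi t := E t + (l / 2) * ln t.
have phid t : T < t -> is_derive t 1 phi (dE t + (l / 2) * t^-1).
  move=> Tt; have t0 : 0 < t by lra.
  have ha := Ed t (lt_trans t1T Tt).
  have pd := is_derive1_ln t0.
  have -> : phi = E + (l / 2) \*: (@ln R : R -> R^o) by apply/funext.
  exact: is_deriveD.
have phile t : T < t -> dE t + (l / 2) * t^-1 <= 0.
  move=> Tt; have t0 : 0 < t by lra.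
  have := dEW t (lt_trans t1T Tt).
  suff : (l / 2) * t^-1 <= W t / t by lra.
  by apply: ler_wpM2r; [rewrite invr_ge0 ltW|exact/ltW/WT/ltW].
pose s := T + 1; have Ts : T < s by rewrite ltrDl.
pose M := 2 * (phi s + 1) / l.
pose t := Num.max s (expR M).
have st : s <= t by rewrite le_max lexx.
have := is_derive_sub_le phid phile Ts st; rewrite mul0r subr_le0 /phi.
have Mt : M <= ln t.
  by rewrite -[M]expRK ler_ln ?posrE ?expR_gt0 ?le_max ?lexx ?orbT// lt_max expR_gt0 orbT.
have lM : l / 2 * M <= l / 2 * ln t by rewrite ler_pM2l//; lra.
have lM' : l / 2 * M = phi s + 1 by rewrite /M; field; lra.
have Et : 0 <= E t by apply: E0; lra.
rewrite -/(phi s); lra.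
Qed.

End Asymptotics.

Section Opial.
Context {R : realType} {H : completeNormedModType R} (ipr : inner_product H).

Lemma ultra_bounded_cvg {T : Type} (G : set_system T) (g : T -> R) (B : R) :
  UltraFilter G -> G [set t | `|g t| <= B] ->
  exists2 l : R, `|l| <= B & g @ G --> l.
Proof.
move=> GU GB.
have GgB : (g @ G) [set` `[- B, B]].
  by apply: (@filterS _ G _ _ _ _ GB) => t gt; rewrite /preimage/= in_itv/= -ler_norml.
have [l [lB lG]] := @segment_compact R (- B) B _ _ GgB.
exists l; first by move: lB; rewrite /= in_itv/= ler_norml.
move=> U Ul; have [//|GU'] := in_ultra_setVsetC (g @^-1` U) GU.
have /lG : (g @ G) (~` U) by [].
by move=> /(_ U Ul) [x []].
Qed.

Lemma ultra_weak_cvg {T : Type} (G : set_system T) (w : T -> H) (B : R) :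
  UltraFilter G -> G [set t | `|w t| <= B] ->
  exists z, forall y, ipr (w t) y @[t --> G] --> ipr z y.
Proof.
move=> GU GB.
have /choice[L LP] : forall y, exists l : R,
    `|l| <= B * `|y| /\ ipr (w t) y @[t --> G] --> l.
  move=> y; have [|l lB lG] := @ultra_bounded_cvg _ G (fun t => ipr (w t) y) (B * `|y|) GU.
    apply: filterS GB => t /= wB; apply: le_trans (cauchy_schwarz _ _ _) _.
    exact: ler_wpM2r.
  by exists l.
have [|x|z zP] := @riesz_representation _ _ ipr L B.
- move=> a x y; apply: (@cvg_unique R^o _ (ipr (w t) (a *: x + y) @[t --> G])) => //.
    exact: (LP _).2.
  have -> : (fun t => ipr (w t) (a *: x + y)) =
      (fun t => a * ipr (w t) x + ipr (w t) y).
    by apply/funext => t; rewrite ip_linear_r.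
  by apply: cvgD (LP y).2; apply: cvgM (LP x).2; exact: cvg_cst.
- exact: (LP x).1.
- by exists z => y; rewrite -zP; exact: (LP y).2.
Qed.

Lemma opial (w : R -> H) (S : set H) : S !=set0 ->
  (forall z, S z -> exists l : R, `|w t - z| ^+ 2 @[t --> +oo] --> l) ->
  (forall (G : set_system R) z, UltraFilter G -> +oo `<=` G ->
     (forall y, ipr (w t) y @[t --> G] --> ipr z y) -> S z) ->
  exists2 z, S z & forall y, ipr (w t) y @[t --> +oo] --> ipr z y.
Proof.
move=> [z0 Sz0] Sl Sw.
have [B wB] : exists B : R, \forall t \near +oo, `|w t| <= B.
  have [l lP] := Sl _ Sz0; exists (l + 2 + `|z0|).
  have ll : l < l + 1 by rewrite ltrDl.
  apply: filterS (cvgr_lt _ lP _ ll) => t wl.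
  have := ler_normD (w t - z0) z0; rewrite subrK => /le_trans; apply.
  rewrite lerD2r; have := sqr_ge0 (`|w t - z0| - 1); nra.
have weak (G : set_system R) : UltraFilter G -> +oo `<=` G ->
    exists2 z, S z & forall y, ipr (w t) y @[t --> G] --> ipr z y.
  move=> GU pG; have [z zP] := ultra_weak_cvg GU (pG _ wB).
  by exists z => //; exact: Sw zP.
have [G0 [G0U pG0]] := ultraFilterLemma (proper_pinfty_nbhs (R := R)).
have [z Sz zP] := weak _ G0U pG0.
exists z => // y; apply/cvgrPdist_lt => e e0; apply: contrapT => ne.
pose A := [set t | ~ `|ipr z y - ipr (w t) y| < e].
have FA : ProperFilter (within A +oo).
  apply: Build_ProperFilter => /= n0; apply: ne.
  have n1 : \forall t \near +oo, A t -> False := n0.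
  by apply: filterS n1 => t /contrapT.
have [G1 [G1U pG1]] := ultraFilterLemma FA.
have ppG1 : +oo `<=` G1.
  by move=> P pP; apply: pG1; apply: filterS pP => t Pt _.
have [z1 Sz1 z1P] := weak _ G1U ppG1.
have [l lP] := Sl _ Sz; have [l1 l1P] := Sl _ Sz1.
pose c := `|z| ^+ 2 - `|z1| ^+ 2.
have cz : ipr (w t) (z - z1) @[t --> +oo] --> (l1 - l + c) / 2.
  have E : (fun t => ipr (w t) (z - z1)) =
      (fun t => (`|w t - z1| ^+ 2 - `|w t - z| ^+ 2 + c) / 2).
    apply/funext => t; rewrite /c -!(ip_norm ipr).
    by rewrite !(ipBl, ipBr) (ip_sym ipr z (w t)) (ip_sym ipr z1 (w t)); field.
  rewrite E; apply: cvgM; last exact: cvg_cst.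
  by apply: cvgD; [exact: cvgB|exact: cvg_cst].
have sub_cvg (G : set_system R) : UltraFilter G -> +oo `<=` G ->
    forall v, (forall y, ipr (w t) y @[t --> G] --> ipr v y) ->
    ipr v (z - z1) = (l1 - l + c) / 2.
  move=> GU pG v vP.
  apply: (@cvg_unique R^o _ (ipr (w t) (z - z1) @[t --> G])) => //.
    exact: vP.
  by move=> U Ul; exact: (pG _ (cz U Ul)).
have zz1 : z = z1.
  apply/eqP; rewrite -subr_eq0; apply/eqP/(ip_eq0 (ipr := ipr)).
  by rewrite ipBl (sub_cvg _ G0U pG0 _ zP) (sub_cvg _ G1U ppG1 _ z1P) subrr.
have GA : G1 A by apply: pG1; apply: nearW => t.
have Ge : G1 [set t | `|ipr z y - ipr (w t) y| < e].
  by have /cvgrPdist_lt := z1P y; rewrite -zz1; exact.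
by have [t [/= ]] := filter_ex (filterI GA Ge).
Qed.

End Opial.

Section Lyapunov.
Context {R : realType}.

Lemma is_derive_mul (f g : R -> R) (t df dg : R) :
  is_derive t 1 f df -> is_derive t 1 g dg ->
  is_derive t 1 (fun s => f s * g s) (df * g t + f t * dg).
Proof. exact: (@is_derive_scale R R^o). Qed.

Lemma is_derive_mulc (c : R) (f : R -> R) (t df : R) :
  is_derive t 1 f df -> is_derive t 1 (fun s => c * f s) (c * df).
Proof. by move=> fd; exact: (@is_deriveZ R R R^o f c t 1 df fd). Qed.

Lemma is_derive_subc {W : normedModType R} (f : R -> W) (c df : W) (t : R) :
  is_derive t 1 f df -> is_derive t 1 (fun s => f s - c) df.
Proof.
move=> fd; have := is_deriveB fd (is_derive_cst c t 1).
by move=> /is_derive_eq; apply; rewrite subr0.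
Qed.

Lemma is_derive_exp (n : nat) (t : R) :
  is_derive t 1 (fun s : R => s ^+ n) (n%:R * t ^+ n.-1).
Proof.
have -> : (fun s : R => s ^+ n) = (@id R : R -> R) ^+ n.
  by apply/funext => s; rewrite fctE.
by apply: is_derive_eq; rewrite [LHS]mulr1.
Qed.

Context {H : completeNormedModType R} (ipr : inner_product H).
Context (t0 alpha m : R) (w w1 w2 g : R -> H) (Fw : R -> R) (z : H).
Context (t0_gt0 : 0 < t0).
Context (w_derive : forall t, t0 < t -> is_derive t 1 w (w1 t)).
Context (w1_derive : forall t, t0 < t -> is_derive t 1 w1 (w2 t)).
Context (ode : forall t y, t0 < t ->
  ipr (w2 t) y = - ((alpha + 1) / t) * ipr (w1 t) y - t / 4 * ipr (g t) y).
Context (Fw_derive : forall t, t0 < t -> is_derive t 1 Fw (ipr (g t) (w1 t))).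
Context (Fw_ge : forall t, t0 < t -> m <= Fw t).
Context (Fw_le : forall t, t0 < t -> Fw t - m <= ipr (g t) (w t - z)).

Definition energy t := t ^+ 3 * (4^-1 * (Fw t - m)) + t ^+ 2 * (2^-1 * ipr (w1 t) (w1 t)).

Definition anchor t :=
  (alpha / 2) * ipr (w t - z) (w t - z) + t * ipr (w t - z) (w1 t).

Lemma energy_derive t : t0 < t -> is_derive t 1 energy
  (3 / 4 * t ^+ 2 * (Fw t - m) - alpha * t * ipr (w1 t) (w1 t)).
Proof.
move=> tt; have tp := lt_trans t0_gt0 tt.
have d1 : is_derive t 1 (fun s => 4^-1 * (Fw s - m)) (4^-1 * ipr (g t) (w1 t)).
  exact/is_derive_mulc/is_derive_subc/Fw_derive.
have d2 : is_derive t 1 (fun s => 2^-1 * ipr (w1 s) (w1 s)) (ipr (w2 t) (w1 t)).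
  have := is_derive_mulc 2^-1 (is_derive_ip ipr (w1_derive tt) (w1_derive tt)).
  by move=> /is_derive_eq; apply; rewrite (ip_sym ipr (w1 t)); field.
have := is_deriveD (is_derive_mul (is_derive_exp 3 t) d1)
                   (is_derive_mul (is_derive_exp 2 t) d2).
by move=> /is_derive_eq; apply; rewrite /= ode//; field; lra.
Qed.

Lemma anchor_derive t : t0 < t -> is_derive t 1 anchor
  (t * ipr (w1 t) (w1 t) - t ^+ 2 / 4 * ipr (g t) (w t - z)).
Proof.
move=> tt; have tp := lt_trans t0_gt0 tt.
have d0 := is_derive_subc z (w_derive tt).
have d1 := is_derive_mulc (alpha / 2) (is_derive_ip ipr d0 d0).
have d2 := is_derive_mul (is_derive_id t 1) (is_derive_ip ipr d0 (w1_derive tt)).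
have := is_deriveD d1 d2.
move=> /is_derive_eq; apply.
by rewrite /= (ip_sym ipr (w t - z) (w2 t)) ode// (ip_sym ipr (w t - z)); field; lra.
Qed.

Definition lyapunov c t := energy t + c * anchor t.

Definition lyapunov' c t :=
  3 / 4 * t ^+ 2 * (Fw t - m) - alpha * t * ipr (w1 t) (w1 t)
  + c * (t * ipr (w1 t) (w1 t) - t ^+ 2 / 4 * ipr (g t) (w t - z)).

Lemma lyapunov_derive c t : t0 < t -> is_derive t 1 (lyapunov c) (lyapunov' c t).
Proof.
move=> tt.
exact: is_deriveD (energy_derive tt) (is_derive_mulc c (anchor_derive tt)).
Qed.

Lemma lyapunov'_le c t : 0 <= c -> t0 < t ->
  lyapunov' c t <= - ((c - 3) * (t ^+ 2 / 4 * (Fw t - m))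
                      + (alpha - c) * (t * ipr (w1 t) (w1 t))).
Proof.
move=> c0 tt; have tp := lt_trans t0_gt0 tt.
have ct : 0 <= c * (t ^+ 2 / 4) by rewrite mulr_ge0// divr_ge0// exprn_ge0// ltW.
by have := ler_wpM2l ct (Fw_le tt); rewrite /lyapunov'; lra.
Qed.

Lemma lyapunov_ge c t : 0 <= c <= alpha -> t0 < t ->
  t ^+ 3 / 4 * (Fw t - m) <= lyapunov c t.
Proof.
move=> /andP[c0 ca] tt.
have E : lyapunov c t = t ^+ 3 / 4 * (Fw t - m)
    + 2^-1 * ipr (c *: (w t - z) + t *: w1 t) (c *: (w t - z) + t *: w1 t)
    + c * (alpha - c) / 2 * ipr (w t - z) (w t - z).
  rewrite /lyapunov /energy /anchor; move: (w t - z) => v.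
  by rewrite !(ipDl, ipDr, ipZl, ipZr) (ip_sym ipr (w1 t) v); field.
have h1 := ip_ge0 ipr (c *: (w t - z) + t *: w1 t).
have h2 : 0 <= c * (alpha - c) / 2 * ipr (w t - z) (w t - z).
  by rewrite mulr_ge0 ?ip_ge0// divr_ge0// mulr_ge0//; lra.
by rewrite E; lra.
Qed.

Lemma lyapunov_ge0 c t : 0 <= c <= alpha -> t0 < t -> 0 <= lyapunov c t.
Proof.
move=> ca tt; apply: le_trans (lyapunov_ge ca tt).
have tp := lt_trans t0_gt0 tt.
have h : 0 <= Fw t - m by rewrite subr_ge0 Fw_ge.
by rewrite mulr_ge0// divr_ge0// exprn_ge0// ltW.
Qed.

Lemma dissipation_ge0 c t : 3 <= c <= alpha -> t0 < t ->
  0 <= (c - 3) * (t ^+ 2 / 4 * (Fw t - m)) + (alpha - c) * (t * ipr (w1 t) (w1 t)).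
Proof.
move=> /andP[c3 ca] tt; have h : 0 <= Fw t - m by rewrite subr_ge0 Fw_ge.
have tp := lt_trans t0_gt0 tt.
apply: addr_ge0; apply: mulr_ge0; rewrite ?subr_ge0//; apply: mulr_ge0 => //.
- by rewrite divr_ge0// exprn_ge0// ltW.
- exact: ltW.
- exact: ip_ge0.
Qed.

Lemma lyapunov_nonincreasing c s t : 3 <= c <= alpha -> t0 < s -> s <= t ->
  lyapunov c t <= lyapunov c s.
Proof.
move=> ca ts st; rewrite -subr_le0 -(mul0r (t - s)).
have c0 : 0 <= c by case/andP: ca; lra.
apply: (is_derive_sub_le (fun x => @lyapunov_derive c x) _ ts st) => x tx.
by apply: le_trans (lyapunov'_le c0 tx) _; rewrite oppr_le0 dissipation_ge0.
Qed.

Lemma energy_rate : 3 <= alpha ->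
  exists2 C, 0 <= C & forall t, t0 + 1 <= t -> t ^+ 3 * (Fw t - m) <= C.
Proof.
move=> a3; have c3 : (3 : R) <= 3 <= alpha by rewrite lexx.
have c0 : 0 <= (3 : R) <= alpha by rewrite a3 ler0n.
have ts : t0 < t0 + 1 by rewrite ltrDl.
exists (4 * lyapunov 3 (t0 + 1)); first by rewrite mulr_ge0// lyapunov_ge0.
move=> t tt; have := lyapunov_ge c0 (lt_le_trans ts tt).
by have := lyapunov_nonincreasing c3 ts tt; lra.
Qed.

Lemma energy_anchor_cvg : 3 < alpha ->
  (exists l : R, energy t @[t --> +oo] --> l) /\
  (exists k : R, anchor t @[t --> +oo] --> k).
Proof.
move=> a3.
have L c : 3 <= c <= alpha -> exists l : R, lyapunov c t @[t --> +oo] --> l.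
  move=> ca; apply: (@nonincreasing_ge0_cvg _ _ t0) => [s t|t].
    exact: lyapunov_nonincreasing.
  by apply: lyapunov_ge0; case/andP: ca => c3 ->; rewrite andbT; lra.
have [|l3 l3P] := L 3; first by rewrite lexx ltW.
have [|la laP] := L alpha; first by rewrite lexx ltW.
have E1 : energy = (fun t => (alpha * lyapunov 3 t - 3 * lyapunov alpha t) / (alpha - 3)).
  by apply/funext => t; rewrite /lyapunov; field; lra.
have E2 : anchor = (fun t => (lyapunov alpha t - lyapunov 3 t) / (alpha - 3)).
  by apply/funext => t; rewrite /lyapunov; field; lra.
split.
  exists ((alpha * l3 - 3 * la) / (alpha - 3)); rewrite E1.
  apply: cvgM; last exact: cvg_cst.
  by apply: cvgB; apply: cvgM => //; exact: cvg_cst.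
exists ((la - l3) / (alpha - 3)); rewrite E2.
by apply: cvgM; [exact: cvgB|exact: cvg_cst].
Qed.

Lemma energy_cvg0 : 3 < alpha -> energy t @[t --> +oo] --> (0 : R).
Proof.
move=> a3; have [[l lP] _] := energy_anchor_cvg a3.
suff l0 : l = 0 by rewrite -l0.
have e0 t : t0 < t -> 0 <= energy t.
  move=> tt; have tp := lt_trans t0_gt0 tt.
  have h : 0 <= Fw t - m by rewrite subr_ge0 Fw_ge.
  by rewrite addr_ge0// mulr_ge0 ?exprn_ge0 ?mulr_ge0 ?ip_ge0// ltW.
apply/le_anti/andP; split; last first.
  rewrite leNgt; apply/negP => l0.
  have [T tT hT] := near_pinftyP t0 (cvgr_lt _ lP _ l0).
  by have := hT T (lexx _); have := e0 _ tT; lra.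
have lP' : (alpha - 3) * energy t @[t --> +oo] --> (alpha - 3) * l.
  by apply: cvgM lP; exact: cvg_cst.
suff : (alpha - 3) * l <= 0 by rewrite pmulr_rle0// subr_gt0.
apply: (@dissipated_limit_le0 _ (fun t => lyapunov 3 t + lyapunov alpha t)
  (fun t => lyapunov' 3 t + lyapunov' alpha t) _ _ t0 _ _ _ _ lP').
- exact: ltW.
- by move=> t tt; rewrite addr_ge0// lyapunov_ge0// ?lexx ?andbT; lra.
- by move=> t tt; apply: is_deriveD; exact: lyapunov_derive.
- move=> t tt; have tp := lt_trans t0_gt0 tt.
  have h1 := @lyapunov'_le 3 t (ler0n _ _) tt.
  have a0 : 0 <= alpha by lra.
  have h2 := lyapunov'_le a0 tt.
  have h3 : 0 <= (alpha - 3) * (t * ipr (w1 t) (w1 t)).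
    by rewrite mulr_ge0 ?mulr_ge0 ?ip_ge0//; lra.
  have -> : (alpha - 3) * energy t / t =
      (alpha - 3) * (t ^+ 2 / 4 * (Fw t - m))
      + 2^-1 * ((alpha - 3) * (t * ipr (w1 t) (w1 t))).
    by rewrite /energy; field; lra.
  by lra.
Qed.

Lemma value_little_o : 3 < alpha -> forall e, 0 < e ->
  \forall t \near +oo, t ^+ 3 * (Fw t - m) <= e.
Proof.
move=> a3 e e0; have e4 : 0 < e / 4 by lra.
have [T tT hT] := near_pinftyP t0 (cvgr_lt _ (energy_cvg0 a3) _ e4).
apply: (@near_pinfty_ge _ _ T) => t Tt; have := hT t Tt.
have h : 0 <= t ^+ 2 * (2^-1 * ipr (w1 t) (w1 t)).
  have tp : 0 < t by exact: lt_le_trans (lt_trans t0_gt0 tT) Tt.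
  by rewrite mulr_ge0 ?exprn_ge0 ?mulr_ge0 ?ip_ge0// ltW.
by rewrite /energy; lra.
Qed.

Lemma dist_cvg : 3 < alpha -> exists l : R, `|w t - z| ^+ 2 @[t --> +oo] --> l.
Proof.
move=> a3; have [_ [k kP]] := energy_anchor_cvg a3.
pose h t := 2^-1 * ipr (w t - z) (w t - z).
have hd t : t0 < t -> is_derive t 1 h (ipr (w t - z) (w1 t)).
  move=> tt; have d0 := is_derive_subc z (w_derive tt).
  have := is_derive_mulc 2^-1 (is_derive_ip ipr d0 d0).
  by move=> /is_derive_eq; apply; rewrite (ip_sym ipr (w1 t)); field.
have hk : alpha * h t + t * ipr (w t - z) (w1 t) @[t --> +oo] --> k.
  rewrite (_ : (fun t => _) = anchor)//; apply/funext => t.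
  by rewrite /anchor /h; field.
have a1 : 1 <= alpha by lra.
have hl := avg_cvg a1 hd hk.
exists (2 * (k / alpha)).
rewrite (_ : (fun t => _) = (fun t => 2 * h t)).
  by apply: cvgM hl; exact: cvg_cst.
by apply/funext => t; rewrite /h (ip_norm ipr); field.
Qed.

End Lyapunov.

(* h(t) = t^3 (F(u) - m) satisfies h + t h' <= 4 t^3 (F(w) - m): u is an average
   of w, and convexity of F enters through the gradient inequality at u. *)
Lemma averaged_value_le {R : realType} {H : normedModType R} (F : H -> R)
    (u u' : R -> H) (t0 m c e : R) : 0 < t0 -> 0 < e ->
  (forall x, differentiable F x) ->
  (forall x y, F x + 'd F x (y - x) <= F y) ->
  (forall t, t0 < t -> is_derive t 1 u (u' t)) ->
  (\forall t \near +oo, t ^+ 3 * (F (u t + (t / 4) *: u' t) - m) <= c) ->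
  \forall t \near +oo, t ^+ 3 * (F (u t) - m) <= 4 * c + e.
Proof.
move=> t00 e0 Fd Fc ud wc.
pose dh t := 3%:R * t ^+ 2 * (F (u t) - m) + t ^+ 3 * 'd F (u t) (u' t).
apply: (@avg_le _ 1 (4 * c) t0 e _ dh) => //.
  move=> t tt; have d1 := is_derive_diff_comp (Fd (u t)) (ud t tt).
  exact: is_derive_mul (is_derive_exp 3 t) (is_derive_subc m d1).
have [T tT wT] := near_pinftyP t0 wc.
apply: (@near_pinfty_ge _ _ T) => t Tt.
have tp : 0 < t ^+ 3 by rewrite exprn_gt0//; lra.
have := Fc (u t) (u t + (t / 4) *: u' t).
rewrite addrAC subrr add0r linearZ /= => h1.
have := wT t Tt; move: h1; rewrite /dh -[_ *: _]/(_ * _).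
set D := 'd F (u t) (u' t); set A := F (u t); set B := F _ => h1 h2.
have h3 : t ^+ 3 * (A + t / 4 * D) <= t ^+ 3 * B by rewrite ler_pM2l.
by lra.
Qed.

Theorem theorem6p1 (R : realType) (H : completeNormedModType R)
  (ipr : inner_product H) (f : H -> \bar R) (lam : R) (t0 alpha : R)
  (u : R -> H) :
  econvex f -> lower_semicontinuous f -> eproper f -> eargmin f !=set0 ->
  0 < lam -> 0 < t0 -> 0 <= alpha ->
  (forall t, t0 < t ->
     [/\ derivable u t 1, derivable (derive1 u) t 1 &
         derivable (derive1 (derive1 u)) t 1]) ->
  (forall t, t0 < t ->
     is_gradient ipr (fun x => fine (moreau f lam x))
       (u t + (t / 4) *: derive1 u t)
       (- (derive1 (derive1 (derive1 u)) t
           + ((alpha + 7) / t) *: derive1 (derive1 u) t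
           + ((5 * (alpha + 1)) / t ^+ 2) *: derive1 u t))) ->
  let w := fun t => u t + (t / 4) *: derive1 u t in
  (3 <= alpha ->
     (exists C : R, \forall t \near +oo,
        [/\ (moreau f lam (w t) - einf f <= (C / t ^+ 3)%:E)%E,
            (f (prox f lam (w t)) - einf f <= (C / t ^+ 3)%:E)%E,
            (moreau f lam (u t) - einf f <= (C / t ^+ 3)%:E)%E &
            (f (prox f lam (u t)) - einf f <= (C / t ^+ 3)%:E)%E])) /\
  (3 < alpha ->
     (forall eps : R, 0 < eps -> \forall t \near +oo,
        [/\ (moreau f lam (w t) - einf f <= (eps / t ^+ 3)%:E)%E,
            (f (prox f lam (w t)) - einf f <= (eps / t ^+ 3)%:E)%E,
            (moreau f lam (u t) - einf f <= (eps / t ^+ 3)%:E)%E &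
            (f (prox f lam (u t)) - einf f <= (eps / t ^+ 3)%:E)%E]) /\
     (exists2 uinf : H, eargmin f uinf &
        forall y : H, ipr (u t) y @[t --> +oo] --> ipr uinf y)).
Proof.
move=> cf lf pf [xs xsP] lam0 t00 alpha0 ud ode w.
pose F x := fine (moreau f lam x); pose m := fine (f xs).
have grad x : exists2 g, is_gradient ipr F x g & forall y, F x + ipr g (y - x) <= F y.
  exact: (moreau_gradient ipr cf lf pf xsP lam0).
have Fd x : differentiable F x by have [g []] := grad x.
have Fc x y : F x + 'd F x (y - x) <= F y.
  by have [g [_ gd]] := grad x; rewrite gd; exact.
have Fm x : m <= F x by exact: (min_le_moreau ipr cf lf pf xsP lam0).
have Fargmin z : eargmin f z -> F z = m by exact: (moreau_argmin ipr cf lf pf xsP lam0).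
pose u1 := derive1 u; pose u2 := derive1 u1; pose u3 := derive1 u2.
have u0d t : t0 < t -> is_derive t 1 u (u1 t).
  by move=> /ud[+ _ _] => /derivableP; rewrite -derive1E.
have u1d t : t0 < t -> is_derive t 1 u1 (u2 t).
  by move=> /ud[_ + _] => /derivableP; rewrite -derive1E.
have u2d t : t0 < t -> is_derive t 1 u2 (u3 t).
  by move=> /ud[_ _] /derivableP; rewrite -derive1E.
have qd (t : R) : is_derive t 1 (fun s : R => s / 4) 4^-1.
  have := is_derive_mulc 4^-1 (is_derive_id t 1).
  rewrite mulr1 (_ : (fun s => 4^-1 * s) = (fun s => s / 4))//.
  by apply/funext => s; rewrite mulrC.
pose w1 t := u1 t + (4^-1 *: u1 t + (t / 4) *: u2 t).
pose w2 t := u2 t + (4^-1 *: u2 t + (4^-1 *: u2 t + (t / 4) *: u3 t)).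
pose g t := - (u3 t + ((alpha + 7) / t) *: u2 t + ((5 * (alpha + 1)) / t ^+ 2) *: u1 t).
have wd t : t0 < t -> is_derive t 1 w (w1 t).
  by move=> tt; exact: is_deriveD (u0d t tt) (is_derive_scale (qd t) (u1d t tt)).
have w1d t : t0 < t -> is_derive t 1 w1 (w2 t).
  move=> tt; apply: is_deriveD (u1d t tt) _; apply: is_deriveD.
    exact: (@is_deriveZ R R H u1 4^-1 t 1 (u2 t) (u1d t tt)).
  exact: is_derive_scale (qd t) (u2d t tt).
have wode t y : t0 < t ->
    ipr (w2 t) y = - ((alpha + 1) / t) * ipr (w1 t) y - t / 4 * ipr (g t) y.
  move=> tt; have tp := lt_trans t00 tt.
  by rewrite /w2 /w1 /g !(ipDl, ipNl, ipZl); field; lra.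
have gE t h : t0 < t -> 'd F (w t) h = ipr (g t) h by move=> /ode[_]; exact.
have Fwd t : t0 < t -> is_derive t 1 (F \o w) (ipr (g t) (w1 t)).
  by move=> tt; rewrite -gE//; exact: is_derive_diff_comp (Fd _) (wd t tt).
have Fwge t : t0 < t -> m <= (F \o w) t by move=> _; exact: Fm.
have Fwle z : eargmin f z -> forall t, t0 < t -> (F \o w) t - m <= ipr (g t) (w t - z).
  move=> /Fargmin zm t tt; have := Fc (w t) z; rewrite gE// zm -(opprB (w t)) ipNr /=.
  by lra.
have gap t c : 0 < t -> t ^+ 3 * (F (w t) - m) <= c -> t ^+ 3 * (F (u t) - m) <= c ->
  [/\ (moreau f lam (w t) - einf f <= (c / t ^+ 3)%:E)%E,
      (f (prox f lam (w t)) - einf f <= (c / t ^+ 3)%:E)%E,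
      (moreau f lam (u t) - einf f <= (c / t ^+ 3)%:E)%E &
      (f (prox f lam (u t)) - einf f <= (c / t ^+ 3)%:E)%E].
  move=> t_gt0 hw hu; have tp : 0 < t ^+ 3 by rewrite exprn_gt0.
  have vg := value_gap_le ipr cf lf pf xsP lam0.
  have [] := vg (w t) (c / t ^+ 3); first by rewrite ler_pdivlMr// mulrC.
  have [] := vg (u t) (c / t ^+ 3); first by rewrite ler_pdivlMr// mulrC.
  by [].
have near_gap c : (\forall t \near +oo, t ^+ 3 * (F (w t) - m) <= c) ->
    (\forall t \near +oo, t ^+ 3 * (F (u t) - m) <= c) ->
  \forall t \near +oo,
  [/\ (moreau f lam (w t) - einf f <= (c / t ^+ 3)%:E)%E,
      (f (prox f lam (w t)) - einf f <= (c / t ^+ 3)%:E)%E,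
      (moreau f lam (u t) - einf f <= (c / t ^+ 3)%:E)%E &
      (f (prox f lam (u t)) - einf f <= (c / t ^+ 3)%:E)%E].
  move=> hw hu; near=> t; apply: gap; last by near: t.
    by near: t; exact: nbhs_pinfty_gt.
  by near: t.
have uavg c e : 0 < e -> (\forall t \near +oo, t ^+ 3 * (F (w t) - m) <= c) ->
    \forall t \near +oo, t ^+ 3 * (F (u t) - m) <= 4 * c + e.
  by move=> e0 wc; exact: averaged_value_le t00 e0 Fd Fc u0d wc.
split=> [a3|a3].
  have [C C0 hC] := energy_rate t00 wd w1d wode Fwd Fwge (Fwle _ xsP) a3.
  have wC : \forall t \near +oo, t ^+ 3 * (F (w t) - m) <= C.
    exact: (near_pinfty_ge hC).
  exists (4 * C + 1); apply: near_gap; last exact: uavg.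
  by apply: filterS wC => t; lra.
have small e : 0 < e -> \forall t \near +oo, t ^+ 3 * (F (w t) - m) <= e.
  by move=> e0; exact: (value_little_o t00 wd w1d wode Fwd Fwge (Fwle _ xsP)).
split.
  move=> eps eps0; have e8 : 0 < eps / 8 by lra.
  apply: near_gap; first exact: small.
  have e2 : 0 < eps / 2 by lra.
  have := uavg _ _ e2 (small _ e8).
  by rewrite (_ : 4 * (eps / 8) + eps / 2 = eps)//; lra.
have [||z zP zw] := @opial _ _ ipr w (eargmin f) (ex_intro _ xs xsP).
- by move=> z zP; exact: (dist_cvg t00 wd w1d wode Fwd Fwge (Fwle _ zP) a3).
- move=> G z GU pG Gz; apply: (argmin_moreau ipr cf lf pf xsP lam0).
  apply/le_anti; rewrite -/(F z) -/m Fm andbT leNgt; apply/negP => mz.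
  have [gz _ gzP] := grad z.
  pose e := (F z - m) / 2; have e0 : 0 < e by rewrite /e; lra.
  have G1 : G [set t | F (w t) < m + e].
    apply: pG; have [T t1T hT] := near_pinftyP 1 (small _ e0).
    apply: (@near_pinfty_ge _ _ (T + 1)) => t Tt.
    have t1 : 1 < t ^+ 3 by rewrite exprn_egt1//; lra.
    have tT : T <= t by lra.
    have := hT t tT; have := Fm (w t) => h1 h2; rewrite /=; nra.
  have G2 : G [set t | ipr (w t) gz > ipr z gz - e].
    have h : ipr z gz - e < ipr z gz by lra.
    exact: (cvgr_gt _ (Gz gz) _ h).
  have [t [/= h1 h2]] := filter_ex (filterI G1 G2).
  have := gzP (w t); rewrite ipBr !(ip_sym ipr gz) => h3.
  have ee : F z = m + 2 * e by rewrite /e; field.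
  by lra.
exists z => // y.
have yd t : t0 < t -> is_derive t 1 (fun s => ipr (u s) y) (ipr (u1 t) y).
  move=> tt; have := is_derive_ip ipr (u0d t tt) (is_derive_cst y t 1).
  by move=> /is_derive_eq; apply; rewrite ip0r addr0.
have four1 : 1 <= (4 : R) by lra.
have lim4 : 4 * ipr (u t) y + t * ipr (u1 t) y @[t --> +oo] --> 4 * ipr z y.
  rewrite (_ : (fun t => _) = (fun t => 4 * ipr (w t) y)).
    by apply: cvgM (zw y); exact: cvg_cst.
  by apply/funext => t; rewrite /w ipDl ipZl; field.
have := avg_cvg four1 yd lim4.
by rewrite mulrAC divff// mul1r.
Unshelve. all: by end_near. Qed.
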